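(* Let $\xi,\xi_1,\xi_2,\dots$ be independent random variables with common distribution function $F$ and finite negative mean $\mathbf E\xi=-a<0$, and let $S_0=0$, $S_n=\xi_1+\cdots+\xi_n$ for $n\ge 1$. (i) Assume that $F$ is long-tailed. Then for any $\varepsilon>0$ there exists $R>0$ such that, for every $x>R$, the stopped sequence $$\widehat G_{a+\varepsilon}\bigl(x-S_{n\wedge\mu_{x-R}}\bigr),\qquad n\ge 0,$$ is a submartingale. (ii) Assume in addition that $F\in\mathcal S^*$. Then for any $\varepsilon>0$ there exists $R>0$ such that, for every $x>R$, the stopped sequence $$\widehat G_{a-\varepsilon}\bigl(x-S_{n\wedge\mu_{x-R}}\bigr),\qquad n\ge 0,$$ is a supermartingale.
   Context: Write $\overline F(x)=1-F(x)$ and $\overline F_s(x)=\int_x^\infty \overline F(u)\,du$. For a real number $c$, define $$G_c(x)=\begin{cases}\overline F_s(x), & x\ge 0,\\ c, & x<0,\end{cases}\qquad \widehat G_c(x)=\min\{G_c(x),c\}.$$ For $y>0$, $\mu_y=\min\{n\ge 0: S_n>y\}$, with $\mu_y=\infty$ if no such $n$ exists (in which case $n\wedge\mu_y=n$). (Sub/super)martingale properties are with respect to the natural filtration generated by $\xi_1,\xi_2,\dots$. $F$ is called long-tailed if $\mathbf E e^{h\xi}=\infty$ for all $h>0$. A distribution function $F$ on $\mathbf R$ belongs to the class $\mathcal S^*$ (strong subexponential) if $$\int_0^x\overline F(x-y)\overline F(y)\,dy\sim 2a_+\overline F(x)\quad\text{as }x\to\infty,$$ where $a_+=\int_0^\infty\overline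 F(y)\,dy\in(0,\infty)$. Here $f(x)\sim g(x)$ as $x\to\infty$ means $f(x)/g(x)\to 1$ (in particular $\overline F(x)>0$ for all $x$). *)

(* Defs.v *)
From HB Require Import structures.
From mathcomp Require Import all_boot all_order all_algebra.
From mathcomp Require Import all_classical all_reals all_analysis.

Set Implicit Arguments.
Unset Strict Implicit.
Unset Printing Implicit Defensive.

Import Order.TTheory GRing.Theory Num.Theory.
Import numFieldNormedType.Exports.

Local Open Scope classical_set_scope.
Local Open Scope ring_scope.

Section tails.
Variable R : realType.
Implicit Types (F f g : R -> R) (c x : R).

Definition tail F x : R := 1 - F x.

(* Real-valued integral: equals 0 by convention when the integral diverges,
   which does not happen when F has a finite mean. *)
Definition itail F x : R :=
  \int[lebesgue_measure]_(u in `[x, +oo[) tail F u.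

Definition Gfun F c x : R := if 0 <= x then itail F x else c.

Definition Ghat F c x : R := Num.min (Gfun F c x) c.

Definition asymp_equiv f g := f x / g x @[x --> +oo] --> (1 : R).

(* Division by 0 yields 0, so asymp_equiv forces tail F to be nonzero
   eventually. *)
Definition strong_subexponential F :=
  let aplus := \int[lebesgue_measure]_(y in `[0, +oo[) tail F y in
  (0 < \int[lebesgue_measure]_(y in `[0%R, +oo[) (tail F y)%:E < +oo)%E /\
  asymp_equiv
    (fun x => \int[lebesgue_measure]_(y in `[0, x]) (tail F (x - y) * tail F y))
    (fun x => 2 * aplus * tail F x).

End tails.

Section processes.
Context d (T : measurableType d) (R : realType) (P : probability T R).

(* All exponential moments are infinite; this condition is often called
   heavy-tailedness instead. *)
Definition long_tailed (X : {RV P >-> R}) :=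
  forall h : R, 0 < h -> ('M_P X h = +oo)%E.

Definition independent_family (I : eqType) (X : I -> {RV P >-> R}) :=
  forall (J : seq I) (B : I -> set R), uniq J ->
    (forall i, i \in J -> measurable (B i)) ->
    (P (\bigcap_(i in [set` J]) (X i @^-1` B i)) =
       \prod_(i <- J) P (X i @^-1` B i))%E.

Definition sigma_meas (G : set (set T)) (X : T -> R) :=
  preimage_set_system setT X measurable `<=` G.

(* Y is a version of E[X | G], for G a sub-sigma-algebra. *)
Definition is_cond_exp (G : set (set T)) (X Y : T -> R) :=
  [/\ sigma_meas G Y, P.-integrable setT (EFin \o Y) &
      forall A, G A -> (\int[P]_(w in A) (Y w)%:E = \int[P]_(w in A) (X w)%:E)%E].

Definition submartingale (Fil : nat -> set (set T)) (X : nat -> T -> R) :=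
  [/\ forall n, sigma_meas (Fil n) (X n),
      forall n, P.-integrable setT (EFin \o X n) &
      forall n, exists Y, is_cond_exp (Fil n) (X n.+1) Y /\
                          {ae P, forall w, X n w <= Y w}].

Definition supermartingale (Fil : nat -> set (set T)) (X : nat -> T -> R) :=
  [/\ forall n, sigma_meas (Fil n) (X n),
      forall n, P.-integrable setT (EFin \o X n) &
      forall n, exists Y, is_cond_exp (Fil n) (X n.+1) Y /\
                          {ae P, forall w, Y w <= X n w}].

(* The index 0 is not part of the walk: xi 0 is the generic variable and the
   increments are xi 1, xi 2, ... *)
Definition natural_filtration (xi : nat -> {RV P >-> R}) (n : nat) :
    set (set T) :=
  <<s \bigcup_(k in [set k | (1 <= k <= n)%N])
        preimage_set_system setT (xi k) measurable >>.

Definition walk (xi : nat -> {RV P >-> R}) (n : nat) (w : T) : R :=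
  \sum_(1 <= k < n.+1) xi k w.

(* First passage time above y; None stands for infinity. *)
Definition passage (xi : nat -> {RV P >-> R}) (y : R) (w : T) : option nat :=
  if pselect (exists n, y < walk xi n w) is left ex
  then Some (ex_minn ex) else None.

End processes.

Definition min_time (n : nat) (m : option nat) : nat :=
  if m is Some k then minn n k else n.

Definition stopped_Ghat d (T : measurableType d) (R : realType)
    (P : probability T R) (F : R -> R) (xi : nat -> {RV P >-> R})
    (c x r : R) (n : nat) (w : T) : R :=
  Ghat F c (x - walk xi (min_time n (passage xi (x - r) w)) w).

(* Main.v *)
Require Import Defs.
From HB Require Import structures.
From mathcomp Require Import all_boot all_order all_algebra.
From mathcomp Require Import all_classical all_reals all_analysis.
From mathcomp Require Import measurable_realfun ring lra.
Import Order.TTheory GRing.Theory Num.Theory.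
Import numFieldNormedType.Exports.
Local Open Scope classical_set_scope.
Local Open Scope ring_scope.

(** Put [c = a + eps] or [c = a - eps], let [tail F] be the tail of the
    increments, [itail F] its integral, and write [Z n] for the stopped walk.
    Whether the walk has already crossed the level [y = x - R0] can be read off
    [Z n] itself, so [Z (n+1)] is [Z n + xi (n+1)] while [Z n <= y], and [Z n]
    afterwards (lemma [stopped_walkS]).  As [xi (n+1)] is independent of the
    first [n] increments, the conditional mean of [Ghat F c (x - Z (n+1))] is a
    function of [Z n]: the mean of [Ghat F c (z - xi 0)] at [z = x - Z n] before
    the crossing, and the current value afterwards
    ([stopped_functional_cond_exp]).  Both martingale properties thus reduce to
    comparing, for all large [z], the mean of [Ghat F c (z - V)] with
    [Ghat F c z = itail F z], where [V] is one increment.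

    Submartingale part ([Ghat_one_step_ge]).  A jump [V = v] with [v <= t] adds
    at least [tail F z * v] to the value, for either sign of [v], because the integrand [tail F] is
    nonincreasing; a jump above [z] sets it to [c]; the other jumps cannot
    lower it.  Averaging, the mean change is at least
    [tail F z * (E(V; V <= t) + c - itail F z)], and the bracket is close to
    [- a + c = eps] once [t] and then [z] are large.

    Supermartingale part ([Ghat_one_step_le]).  By Tonelli's theorem the mean
    gain from the jumps in [0, z] is at most
    [self_conv (tail F) z - tail F z * (integral of tail F over [0, z])], which
    under strong subexponentiality is [(p + o(1)) * tail F z] with [p] the mean
    of the positive part of [V].  Jumps above [z] gain at most [c] with
    probability [tail F z].  A negative jump of size [v <= K] loses at least
    [v * tail F (z + K)], which is close to [v * tail F z]:
    strong subexponentiality makes [tail F] insensitive to shifts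
    ([strong_subexp_shift]).  With [m] the mean of the negative part, the total
    is [(c + p - m + o(1)) * tail F z = (- eps + o(1)) * tail F z], which is
    eventually nonpositive.  When [a <= eps] the process is constant. *)

(** * Laws and independence *)

Section probability.
Context d (T : measurableType d) (R : realType) (P : probability T R).

(** The rays [(r, +oo)] form a pi-system generating the Borel sets, and their
    masses are determined by the distribution function. *)
Lemma eq_cdf_distribution (X Y : {RV P >-> R}) : cdf X =1 cdf Y ->
  forall B, measurable B -> distribution P X B = distribution P Y B.
Proof.
move=> XY B mB.
apply: (measure_unique (@measurable_realfun.RGenOInfty.G R)
  (fun n => `](- n%:R), +oo[%classic)) => //.
- exact: measurable_realfun.RGenOInfty.measurableE.
- move=> _ _ [r ->] [s ->]; exists (Num.max r s).
  by apply/seteqP; split => z /=; rewrite !in_itv/= !andbT gt_max => /andP.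
- by move=> i; exists (- i%:R).
- apply/seteqP; split => // z _; exists (Num.truncn `|z|).+1 => //=.
  rewrite in_itv/= andbT ltrNl (le_lt_trans _ (truncnS_gt _))//.
  by rewrite -normrN ler_norm.
- by move=> _ [r ->]; have /(congr1 (fun t => (1 - t)%E)) := XY r;
  rewrite -!ccdf_1_cdf.
- by move=> k; rewrite -ge0_fin_numE//; apply: fin_num_measure; exact: measurable_itv.
Qed.

Lemma eq_cdf_integral (X Y : {RV P >-> R}) (f : R -> R) : cdf X =1 cdf Y ->
  measurable_fun setT f -> (forall r, 0 <= f r) ->
  (\int[P]_w (f (X w))%:E = \int[P]_w (f (Y w))%:E)%E.
Proof.
move=> XY mf f0.
have mE : measurable_fun [set: R] (fun r : R => (f r)%:E) by exact/measurable_EFinP.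
have fE (Z : {RV P >-> R}) :
    (\int[P]_w (f (Z w))%:E = \int[distribution P Z]_r (f r)%:E)%E.
  by rewrite ge0_integral_distribution// => r; rewrite lee_fin.
rewrite !fE; apply: eq_measure_integral => A mA _; exact: eq_cdf_distribution.
Qed.

(** Independence identifies the law of the pair [(U, V)] with the product of
    the marginal laws.  Letting [U] take values in an arbitrary measurable space
    makes it possible to take for [U] the identity map into the space [T]
    equipped with a sub-sigma-algebra, which turns the statement into a formula
    for integrals conditional on that sub-sigma-algebra. *)
Lemma indep_integral d' (T' : measurableType d') (U : {mfun T >-> T'})
    (V : {RV P >-> R}) (g : T' * R -> R) :
  (forall A B, measurable A -> measurable B ->
     P (U @^-1` A `&` V @^-1` B) = (P (U @^-1` A) * P (V @^-1` B))%E) ->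
  measurable_fun [set: T' * R] g -> (forall z, 0 <= g z) ->
  (\int[P]_w (g (U w, V w))%:E = \int[P]_w \int[P]_w' (g (U w, V w'))%:E)%E.
Proof.
move=> UV mg g0.
have mgE : measurable_fun [set: T' * R] (fun z : T' * R => (g z)%:E).
  exact/measurable_EFinP.
have mUV : measurable_fun setT (fun w => (U w, V w)) by exact/measurable_fun_pair.
pose UVm : {mfun T >-> (T' * R)%type} := mfun_Sub (mem_set mUV).
transitivity (\int[distribution P UVm]_z (g z)%:E)%E.
  by rewrite ge0_integral_distribution// => z; rewrite lee_fin.
transitivity (\int[(distribution P U \x distribution P V)%E]_z (g z)%:E)%E.
  apply: eq_measure_integral => A mA _; apply/esym.
  by apply: product_measure_unique => // B C mB mC; exact: UV.
rewrite fubini_tonelli1//.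
rewrite /fubini_F ge0_integral_distribution; last 2 first.
- exact: (measurable_fun_fubini_tonelli_F _ mgE).
- by move=> u; apply: integral_ge0 => v _; rewrite lee_fin.
apply: eq_integral => w _ /=.
rewrite ge0_integral_distribution//; last by move=> v; rewrite lee_fin.
apply/measurable_EFinP; apply: measurableT_comp => //.
Qed.

Lemma sigma_measP (G : set (set T)) (f : T -> R) :
  sigma_meas <<s G >> f <->
  measurable_fun [set: g_sigma_algebraType G] (f : g_sigma_algebraType G -> R).
Proof.
split=> [sf _ B mB|mf _ [B mB <-]]; first by apply: sf; exists B.
exact: mf.
Qed.

(** The generators of [natural_filtration xi n], named in order to form the
    measurable type [g_sigma_algebraType (increment_events xi n)]. *)
Definition increment_events (xi : nat -> {RV P >-> R}) (n : nat) : set (set T) :=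
  \bigcup_(k in [set k | (1 <= k <= n)%N])
    preimage_set_system setT (xi k) measurable.

Lemma increment_events_measurable (xi : nat -> {RV P >-> R}) n :
  increment_events xi n `<=` measurable.
Proof. by move=> _ [k _ [B mB <-]]; exact: measurable_funPT. Qed.

Lemma natural_filtration_measurable (xi : nat -> {RV P >-> R}) n A :
  natural_filtration xi n A -> measurable A.
Proof.
move=> FA; apply: (@smallest_sub _ (sigma_algebra setT) _ _ _ _ A FA).
- exact: sigma_algebra_measurable.
- exact: increment_events_measurable.
Qed.

Lemma natural_filtrationS (xi : nat -> {RV P >-> R}) n :
  natural_filtration xi n `<=` natural_filtration xi n.+1.
Proof.
apply: sub_sigma_algebra2 => A [k /= /andP[k1 kn] kA].
by exists k => //=; rewrite k1 leqW.
Qed.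

(** The hypothesis only speaks of finite intersections of events about single
    increments.  These form a pi-system generating the sigma-algebra of the first
    [n] increments, on which the two finite measures [A |-> P (A and xi (n+1) in B)]
    and [A |-> P A * P (xi (n+1) in B)] agree. *)
Lemma increment_indep (xi : nat -> {RV P >-> R}) n :
  independent_family xi ->
  forall A B, natural_filtration xi n A -> measurable B ->
  P (A `&` xi n.+1 @^-1` B) = (P A * P (xi n.+1 @^-1` B))%E.
Proof.
move=> ind A B FA mB.
pose G : set (set T) := [set A | exists2 C : nat -> set R,
  (forall k, measurable (C k)) &
  A = \bigcap_(k in [set` iota 1 n]) (xi k @^-1` C k)].
have mG : G `<=` measurable.
  move=> _ [C mC ->]; apply: bigcap_measurableType => // k _.
  exact: measurable_funPTI.
have mxB : measurable (xi n.+1 @^-1` B) by exact: measurable_funPTI.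
have pB0 : (0 <= fine (P (xi n.+1 @^-1` B)))%R by rewrite fine_ge0.
have GT : G setT.
  exists (fun=> setT) => //; apply/seteqP; split => // w _ k _ //.
pose m1 := mrestr P mxB.
pose m2 := mscale (NngNum pB0) P.
have m12 : m1 A = m2 A.
  apply: (g_sigma_algebra_measure_unique G mG (fun=> setT)) => //.
  - by rewrite bigcup_const//; exists 0%N.
  - move=> _ _ [C mC ->] [D mD ->]; exists (fun k => C k `&` D k).
      by move=> k; exact: measurableI.
    by rewrite -bigcapI.
  - move=> _ [C mC ->]; rewrite /m1 /m2 /mrestr /mscale/=.
    pose E k := if k == n.+1 then B else C k.
    have mE k : measurable (E k) by rewrite /E; case: ifP.
    have En : E n.+1 = B by rewrite /E eqxx.
    have nin : n.+1 \notin iota 1 n by rewrite mem_iota add1n ltnn andbF.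
    have EC k : k \in iota 1 n -> E k = C k.
      by rewrite /E; case: eqP => // ->; rewrite (negbTE nin).
    have := ind (n.+1 :: iota 1 n) E.
    rewrite cons_uniq nin iota_uniq => /(_ isT (fun k _ => mE k)).
    rewrite big_cons En.
    have -> : (\prod_(j <- iota 1 n) P (xi j @^-1` E j) =
              P (\bigcap_(k in [set` iota 1 n]) (xi k @^-1` C k)))%E.
      rewrite -[LHS](ind (iota 1 n) E (iota_uniq _ _) (fun k _ => mE k)).
      by congr (P _); apply: eq_bigcapr => k /= kn; rewrite EC.
    rewrite /mrestr /mscale/= fineK ?fin_num_measure// => <-; congr (P _).
    apply/seteqP; split => w /=.
      move=> [wC wB] k /=; rewrite inE => /orP[/eqP ->|kn].
        by rewrite En.
      by rewrite EC//; exact: wC.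
    move=> wE; split.
      by move=> k kn; rewrite -EC//; apply: wE => /=; rewrite inE kn orbT.
    by have := wE n.+1; rewrite En; apply; rewrite /= inE eqxx.
  - move=> k; rewrite -ge0_fin_numE//; exact: fin_num_measure.
  - apply: (@smallest_sub _ (sigma_algebra setT) _ _ _ _ A FA).
      exact: smallest_sigma_algebra.
    move=> _ [k /= kn [D mD <-]]; apply: sub_sigma_algebra.
    exists (fun j => if j == k then D else setT).
      by move=> j; case: ifP.
    rewrite setTI; apply/seteqP; split => w /=.
      by move=> wD j _ /=; case: eqP => // ->.
    move=> /(_ k); rewrite eqxx; apply.
    by rewrite /= mem_iota add1n ltnS.
by move: m12; rewrite /m1 /m2 /mrestr /mscale/= fineK ?fin_num_measure// muleC.
Qed.

(** * The stopped walk as a Markov chain *)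

Definition stopped_walk (xi : nat -> {RV P >-> R}) (y : R) n w : R :=
  walk xi (min_time n (passage xi y w)) w.

Lemma walkS (xi : nat -> {RV P >-> R}) n w :
  walk xi n.+1 w = walk xi n w + xi n.+1 w.
Proof. by rewrite /walk big_nat_recr. Qed.

Lemma stopped_walk0 (xi : nat -> {RV P >-> R}) y w : stopped_walk xi y 0 w = 0.
Proof.
rewrite /stopped_walk; case: passage => [k|]; rewrite /= ?min0n /walk big_geq//.
Qed.

(** The passage time disappears from the recursion: before the crossing every
    value of the walk is at most [y], while the value at the crossing, where
    the walk is frozen, exceeds [y]. *)
Lemma stopped_walkS (xi : nat -> {RV P >-> R}) y n w :
  stopped_walk xi y n.+1 w =
  if stopped_walk xi y n w <= y then stopped_walk xi y n w + xi n.+1 w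
  else stopped_walk xi y n w.
Proof.
rewrite /stopped_walk /passage; case: pselect => [ex|nex] /=; last first.
  rewrite ifT ?walkS// leNgt; apply/negP => yn; apply: nex; by exists n.
case: ex_minnP => m ym mmin; case: (ltnP n m) => nm.
  rewrite (minn_idPl nm) ifT ?walkS//.
  by rewrite leNgt; apply: contraTN nm => /mmin; rewrite -leqNgt.
by rewrite (minn_idPr (leqW nm)) ifF// leNgt ym.
Qed.

Lemma stopped_walk_adapted (xi : nat -> {RV P >-> R}) y n :
  measurable_fun [set: g_sigma_algebraType (increment_events xi n)]
    (stopped_walk xi y n : g_sigma_algebraType (increment_events xi n) -> R).
Proof.
elim: n => [|n IH].
  rewrite (_ : stopped_walk xi y 0 = cst 0)//.
  by apply/funext => w; exact: stopped_walk0.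
set GT := g_sigma_algebraType _.
have mZ : measurable_fun [set: GT] (stopped_walk xi y n : GT -> R).
  move=> _ B mB; rewrite setTI; apply: (@natural_filtrationS xi n).
  by rewrite -[X in _ X]setTI; exact: IH.
have mx : measurable_fun [set: GT] (xi n.+1 : GT -> R).
  move=> _ B mB; apply: sub_sigma_algebra; exists n.+1; first by rewrite /= leqnn.
  by exists B.
rewrite (_ : stopped_walk xi y n.+1 = fun w =>
  if stopped_walk xi y n w <= y then stopped_walk xi y n w + xi n.+1 w
  else stopped_walk xi y n w); last by apply/funext => w; exact: stopped_walkS.
apply: measurable_fun_if => //.
- exact: measurable_fun_ler.
- by apply: measurable_funD; exact: measurable_funTS.
- exact: measurable_funTS.
Qed.

(** * Conditional expectation of functionals of the stopped walk *)

Definition mean_step (V : {RV P >-> R}) (K : R -> R) (s : R) : R :=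
  fine (\int[P]_w (K (s + V w))%:E).

Lemma bounded_integrable (f : T -> R) (c : R) : measurable_fun setT f ->
  (forall w, 0 <= f w <= c) -> P.-integrable setT (EFin \o f).
Proof.
move=> mf f0c; apply: (@le_integrable _ _ _ P _ measurableT _ (EFin \o cst c)).
- exact/measurable_EFinP.
- move=> w _ /=; rewrite lee_fin; have /andP[f0 fc] := f0c w.
  by rewrite !ger0_norm// (le_trans f0).
- exact: finite_measure_integrable_cst.
Qed.

Section bounded_functional.
Variables (V : {RV P >-> R}) (K : R -> R) (c : R).
Hypothesis mK : measurable_fun setT K.
Hypothesis K0c : forall s, 0 <= K s <= c.

Let mKV s : measurable_fun setT (fun w => K (s + V w)).
Proof. by apply: measurableT_comp => //; exact: measurable_funD. Qed.

Lemma mean_stepE s : (mean_step V K s)%:E = (\int[P]_w (K (s + V w))%:E)%E.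
Proof.
by rewrite fineK//; apply: integrable_fin_num => //; exact: (@bounded_integrable _ c).
Qed.

Lemma mean_step_bounded s : 0 <= mean_step V K s <= c.
Proof.
rewrite -!lee_fin mean_stepE; apply/andP; split.
  by apply: integral_ge0 => w _; rewrite lee_fin; have /andP[] := K0c (s + V w).
apply: (@le_trans _ _ (\int[P]_w (cst c%:E) w)%E).
  apply: ge0_le_integral => //.
  - by move=> w _; rewrite lee_fin; have /andP[] := K0c (s + V w).
  - exact/measurable_EFinP.
  - by move=> w _; rewrite lee_fin; have /andP[] := K0c (s + V w).
by rewrite integral_cst//= probability_setT mule1.
Qed.

Lemma mean_step_measurable : measurable_fun setT (mean_step V K).
Proof.
apply/measurable_EFinP.
pose f (z : R * T) : \bar R := (K (z.1 + V z.2))%:E.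
rewrite (_ : EFin \o _ = fubini_F P f); last first.
  by apply/funext => s /=; rewrite mean_stepE.
apply: measurable_fun_fubini_tonelli_F.
  apply/measurable_EFinP; apply: measurableT_comp => //.
  by apply: measurable_funD => //; exact: measurableT_comp.
by move=> z; rewrite lee_fin; have /andP[] := K0c (z.1 + V z.2).
Qed.

End bounded_functional.

Section stopped_functional.
Variables (xi : nat -> {RV P >-> R}) (K : R -> R) (c y : R).
Hypothesis xi_indep : independent_family xi.
Hypothesis xi_cdf : forall k, cdf (xi k) =1 cdf (xi 0%N).
Hypothesis mK : measurable_fun setT K.
Hypothesis K0c : forall s, 0 <= K s <= c.

Let K0 s : 0 <= K s. Proof. by have /andP[] := K0c s. Qed.

Let X n w := K (stopped_walk xi y n w).

(** The conditional mean of [X n.+1]: before the crossing the next increment is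
    averaged out, after it the process is frozen. *)
Definition stopped_mean n w :=
  if stopped_walk xi y n w <= y
  then mean_step (xi 0%N) K (stopped_walk xi y n w)
  else K (stopped_walk xi y n w).

Lemma stopped_functional_adapted n : sigma_meas (natural_filtration xi n) (X n).
Proof.
apply/sigma_measP; apply: measurableT_comp => //; exact: stopped_walk_adapted.
Qed.

Lemma sigma_meas_integrable n (f : T -> R) : (forall w, 0 <= f w <= c) ->
  sigma_meas (natural_filtration xi n) f -> P.-integrable setT (EFin \o f).
Proof.
move=> f0c sf; apply: (@bounded_integrable _ c) => // _ B mB.
by apply: (@natural_filtration_measurable xi n); apply: sf; exists B.
Qed.

Lemma stopped_functional_cond_exp n :
  is_cond_exp P (natural_filtration xi n) (X n.+1) (stopped_mean n).
Proof.
set GT := g_sigma_algebraType (increment_events xi n).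
have mZ := stopped_walk_adapted xi y n; rewrite -/GT in mZ.
have mphi := mean_step_measurable (xi 0%N) _ _ mK K0c.
have sY : sigma_meas (natural_filtration xi n) (stopped_mean n).
  apply/sigma_measP; apply: measurable_fun_if => //.
  - exact: measurable_fun_ler.
  - by apply: measurable_funTS; exact: measurableT_comp.
  - by apply: measurable_funTS; exact: measurableT_comp.
have Y0c w : 0 <= stopped_mean n w <= c.
  by rewrite /stopped_mean; case: ifP => // _; exact: mean_step_bounded.
split=> //; first exact: sigma_meas_integrable sY.
move=> A FA; have mA := natural_filtration_measurable _ _ _ FA.
pose step (u : T) (v : R) : R :=
  if stopped_walk xi y n u <= y then K (stopped_walk xi y n u + v)
  else K (stopped_walk xi y n u).
(* [g] carries the indicator of [A], so that testing against [A] becomes a plain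
   integral over [T]. *)
pose g (z : GT * R) : R := \1_A z.1 * step z.1 z.2.
have g0 z : 0 <= g z.
  by rewrite mulr_ge0// /step; case: ifP => _; exact: K0.
have mid : measurable_fun [set: T] (fun w : T => w : GT).
  by move=> _ B mB; rewrite setTI; exact: (natural_filtration_measurable xi n B mB).
pose U : {mfun T >-> GT} := mfun_Sub (mem_set mid).
have mg : measurable_fun [set: GT * R] g.
  apply: measurable_funM.
    by apply: (measurableT_comp (f := \1_A : GT -> R)) => //; exact: measurable_indic.
  have mZ1 : measurable_fun [set: GT * R] (fun z => stopped_walk xi y n z.1).
    exact: (measurableT_comp mZ).
  apply: measurable_fun_if => //.
  - exact: measurable_fun_ler.
  - apply: measurable_funTS; apply: measurableT_comp => //.
    exact: measurable_funD.
  - by apply: measurable_funTS; exact: measurableT_comp.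
have XE w : (X n.+1 w) = step w (xi n.+1 w).
  by rewrite /X stopped_walkS /step; case: ifP.
rewrite integral_mkcond [RHS]integral_mkcond.
transitivity (\int[P]_w (g (U w, xi n.+1 w))%:E)%E; last first.
  apply: eq_integral => w _; rewrite patchE /g /= indicE.
  by case: ifP; rewrite ?mul0r ?mul1r ?XE.
rewrite indep_integral//; last first.
  by move=> B C mB mC; exact: increment_indep.
apply: eq_integral => w _; rewrite patchE /g /= indicE.
case: ifP => wA; last first.
  by rewrite integral0_eq// => w' _; rewrite mul0r.
under eq_integral do rewrite mul1r.
rewrite /stopped_mean /step; case: ifP => _.
  rewrite (mean_stepE _ _ c)//.
  apply: (eq_cdf_integral (xi 0%N) (xi n.+1) (fun v => K (stopped_walk xi y n w + v))).
  - by move=> r; rewrite xi_cdf.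
  - by apply: measurableT_comp => //; exact: measurable_funD.
  - by move=> r; exact: K0.
by rewrite integral_cst//= probability_setT mule1.
Qed.

Lemma stopped_submartingale :
  (forall s, s <= y -> K s <= mean_step (xi 0%N) K s) ->
  submartingale P (natural_filtration xi) X.
Proof.
move=> Kle; split=> n; first exact: stopped_functional_adapted.
  apply: (sigma_meas_integrable n) (stopped_functional_adapted n) => w.
  exact: K0c.
exists (stopped_mean n); split; first exact: stopped_functional_cond_exp.
by apply: aeW => w; rewrite /X /stopped_mean; case: ifP => // /Kle.
Qed.

Lemma stopped_supermartingale :
  (forall s, s <= y -> mean_step (xi 0%N) K s <= K s) ->
  supermartingale P (natural_filtration xi) X.
Proof.
move=> Kle; split=> n; first exact: stopped_functional_adapted.
  apply: (sigma_meas_integrable n) (stopped_functional_adapted n) => w.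
  exact: K0c.
exists (stopped_mean n); split; first exact: stopped_functional_cond_exp.
by apply: aeW => w; rewrite /X /stopped_mean; case: ifP => // /Kle.
Qed.

End stopped_functional.
End probability.

(** * Integrals of nonincreasing functions *)

Lemma Rintegral_itv_split (R : realType) (g : R -> R) (b : itv_bound R) (x y : R) :
  (@lebesgue_measure R).-integrable [set` Interval (BLeft x) b] (EFin \o g) ->
  x <= y -> (BRight y <= b)%O ->
  \int[lebesgue_measure]_(u in [set` Interval (BLeft x) b]) g u =
  \int[lebesgue_measure]_(u in `[x, y]) g u +
  \int[lebesgue_measure]_(u in [set` Interval (BLeft y) b]) g u.
Proof.
move=> ig xy yb; apply/eqP; rewrite addrC -subr_eq; apply/eqP.
rewrite Rintegral_itvB//.
rewrite Rintegral_itv_obnd_cbnd//; apply: integrableS ig => //.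
by apply: subset_itvr; rewrite bnd_simp.
Qed.

(** The map [u |-> x - u] sends an interval to one of the same length, hence
    preserves Lebesgue measure.  Arguing on the measure and not through
    antiderivatives covers discontinuous integrands such as distribution tails. *)
Lemma integral_reflect (R : realType) (x : R) (g : R -> R) (D : set R) :
  measurable D -> measurable_fun [set: R] g -> (forall u, 0 <= g u) ->
  (\int[lebesgue_measure]_(u in (fun u => (x - u)%R) @^-1` D) (g (x - u))%:E =
   \int[lebesgue_measure]_(u in D) (g u)%:E)%E.
Proof.
move=> mD mg g0.
pose S := measurableTypeR R.
have mr : measurable_fun [set: S] (fun u : S => (x - u : S)).
  by apply: (@measurable_funB _ _ _ _ (cst x) id) => //; exact: measurable_cst.
pose r : {mfun S >-> S} := @mfun_Sub _ _ S S _ (mem_set mr).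
have rE (A : set S) : measurable A ->
    lebesgue_measure A = pushforward lebesgue_measure r A.
  apply: lebesgue_measure_unique => _ [[a b] _ <-] /=.
  rewrite /pushforward.
  have -> : r @^-1` `]a, b] = `[x - b, x - a[%classic.
    by apply/seteqP; split => u /=; rewrite !in_itv/= => /andP[? ?];
      apply/andP; split; lra.
  rewrite !lebesgue_measure_itv/= !lte_fin ltrD2l ltrN2.
  by case: ifP => // _; rewrite -!EFinB; congr (_%:E); ring.
transitivity (\int[pushforward lebesgue_measure r]_(u in D) (g u)%:E)%E.
  rewrite ge0_integral_pushforward//.
    by apply: measurable_funTS; exact/measurable_EFinP.
  by move=> u _; rewrite lee_fin.
apply: eq_measure_integral => A mA _; exact/esym/rE.
Qed.

Section nonincreasing_tails.
Context (R : realType).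
Let mu := @lebesgue_measure R.
Variable f : R -> R.
Hypothesis f_le : {homo f : x y /~ x <= y}.
Hypothesis f_ge0 : forall x, 0 <= f x.
Hypothesis f_int : (\int[mu]_(u in `[0%R, +oo[) (f u)%:E < +oo)%E.

Lemma noninc_measurable : measurable_fun [set: R] f.
Proof. by apply: nonincreasing_measurable => // x y xy; exact: f_le. Qed.

Let mf := noninc_measurable.

Lemma tail_integrable x : 0 <= x -> mu.-integrable `[x, +oo[ (EFin \o f).
Proof.
move=> x0; apply: (@integrableS _ _ _ mu `[0, +oo[) => //.
  by apply: subset_itvr; rewrite bnd_simp.
apply/integrableP; split; first by apply: measurable_funTS; exact/measurable_EFinP.
by under eq_integral do rewrite /= ger0_norm//.
Qed.

Lemma seg_integrable x y : 0 <= x -> mu.-integrable `[x, y] (EFin \o f).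
Proof.
move=> x0; apply: integrableS (tail_integrable _ x0) => //.
exact: subset_itvl.
Qed.

Lemma tail_split x y : 0 <= x -> x <= y ->
  \int[mu]_(u in `[x, +oo[) f u =
  \int[mu]_(u in `[x, y]) f u + \int[mu]_(u in `[y, +oo[) f u.
Proof.
move=> x0 xy; apply: Rintegral_itv_split => //; exact: tail_integrable.
Qed.

Lemma seg_split x y z : 0 <= x -> x <= y -> y <= z ->
  \int[mu]_(u in `[x, z]) f u =
  \int[mu]_(u in `[x, y]) f u + \int[mu]_(u in `[y, z]) f u.
Proof.
move=> x0 xy yz; apply: Rintegral_itv_split => //; exact: seg_integrable.
Qed.

Let seg_ge0 (D : set R) : 0 <= \int[mu]_(u in D) f u.
Proof. exact: Rintegral_ge0. Qed.

Lemma cst_integrable x y c : mu.-integrable `[x, y] (EFin \o cst c).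
Proof.
apply/integrableP; split; first exact/measurable_EFinP.
rewrite /= integral_cst//= /mu lebesgue_measure_itv/=.
by case: ifP => _; rewrite -?EFinB -?EFinM ltry.
Qed.

Lemma seg_cst x y c : x <= y -> \int[mu]_(u in `[x, y]) c = (y - x) * c.
Proof.
move=> xy; rewrite Rintegral_cst//= /mu lebesgue_measure_itv/= lte_fin.
by have [_|yx] := ltP x y; rewrite mulrC//= (le_anti (introT andP (conj xy yx))) subrr.
Qed.

Lemma seg_ge x y : 0 <= x -> x <= y -> (y - x) * f y <= \int[mu]_(u in `[x, y]) f u.
Proof.
move=> x0 xy; rewrite -seg_cst//; apply: le_Rintegral => //.
- exact: cst_integrable.
- exact: seg_integrable.
- by move=> u /=; rewrite in_itv/= => /andP[_]; exact: f_le.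
Qed.

Lemma seg_le x y : 0 <= x -> x <= y -> \int[mu]_(u in `[x, y]) f u <= (y - x) * f x.
Proof.
move=> x0 xy; rewrite -seg_cst//; apply: le_Rintegral => //.
- exact: seg_integrable.
- exact: cst_integrable.
- by move=> u /=; rewrite in_itv/= => /andP[+ _]; exact: f_le.
Qed.

Lemma tail_noninc x y : 0 <= x -> x <= y ->
  \int[mu]_(u in `[y, +oo[) f u <= \int[mu]_(u in `[x, +oo[) f u.
Proof. by move=> x0 xy; rewrite (tail_split _ _ x0 xy) lerDr seg_ge0. Qed.

(** Monotonicity of the tail integral transfers its convergence along the
    integers to convergence at infinity. *)
Lemma tail_cvg0 : \int[mu]_(u in `[x, +oo[) f u @[x --> +oo] --> 0.
Proof.
set J := fun x : R => \int[mu]_(u in `[x, +oo[) f u.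
have Jn : J n%:R @[n --> \oo] --> 0.
  have An : \int[mu]_(u in `[0, n%:R]) f u @[n --> \oo] --> J 0.
    apply: fine_cvg; rewrite fineK.
      exact: ge0_cvgn_integral f_ge0 mf.
    by apply: integrable_fin_num => //; exact: tail_integrable.
  have -> : (fun n => J n%:R) = (fun n => J 0 - \int[mu]_(u in `[0, n%:R]) f u).
    by apply/funext => n; rewrite /J (tail_split 0 n%:R)// addrC addKr.
  by have := cvgB (cvg_cst (J 0)) An; rewrite subrr; exact.
apply/cvgrPdist_le => /= e e0.
have /cvgrPdist_le/(_ e e0)[N _ HN] := Jn.
near=> x; rewrite sub0r normrN ger0_norm; last by exact: seg_ge0.
have := HN N (leqnn _); rewrite sub0r normrN ger0_norm; last by exact: seg_ge0.
by apply: le_trans; apply: tail_noninc => //; near: x; exact: nbhs_pinfty_ge.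
Unshelve. all: by end_near. Qed.

(** * Strong subexponentiality *)

Definition self_conv (x : R) := \int[mu]_(y in `[0, x]) (f (x - y) * f y).

Let conv_integrand_measurable x : measurable_fun [set: R] (fun y => f (x - y) * f y).
Proof.
apply: measurable_funM => //; apply: measurableT_comp => //.
exact: measurable_funB.
Qed.

Lemma self_conv_integrable x : mu.-integrable `[0, x] (EFin \o (fun y => f (x - y) * f y)).
Proof.
apply: (@le_integrable _ _ _ mu _ _ _ (EFin \o (fun y => f 0 * f y))) => //.
- by apply: measurable_funTS; apply/measurable_EFinP; exact: conv_integrand_measurable.
- move=> y /=; rewrite in_itv/= => /andP[y0 yx].
  rewrite lee_fin !ger0_norm ?mulr_ge0// ler_wpM2r//.
  by apply: f_le; rewrite subr_ge0.
- exact: (integrableZl _ (f 0) (seg_integrable 0 x (lexx _))).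
Qed.

(** The convolution at [2h] is cut at [K] and [h].  On [0, K] the first factor
    is at least [f (2h)]; on [K, h] it is at least [f (2h - K)]; on [h, 2h] the
    second factor is at least [f (2h)], and the integral of the first one over
    [h, 2h] is that of [f] over [0, h] by reflection. *)
Lemma self_conv_ge K h : 0 <= K -> K <= h ->
  f (h + h) * \int[mu]_(u in `[0, K]) f u + f (h + h - K) * \int[mu]_(u in `[K, h]) f u +
  f (h + h) * \int[mu]_(u in `[0, h]) f u <= self_conv (h + h).
Proof.
move=> K0 Kh; have h0 := le_trans K0 Kh; have hh : h <= h + h by rewrite lerDl.
have ci := self_conv_integrable (h + h).
rewrite /self_conv (Rintegral_itv_split _ _ _ _ h ci)//.
have cih : mu.-integrable `[0, h] (EFin \o (fun y => f (h + h - y) * f y)).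
  by apply: integrableS ci => //; apply: subset_itvl; rewrite bnd_simp.
rewrite (Rintegral_itv_split _ _ _ _ K cih)//.
rewrite lerD//; first rewrite lerD//.
- rewrite -RintegralZl//; last exact: seg_integrable.
  apply: le_Rintegral => //.
  + exact: (integrableZl _ _ (seg_integrable 0 K (lexx _))).
  + by apply: integrableS cih => //; apply: subset_itvl; rewrite bnd_simp.
  + move=> u /=; rewrite in_itv/= => /andP[u0 uK].
    by rewrite ler_wpM2r//; apply: f_le; rewrite gerDl oppr_le0.
- rewrite -RintegralZl//; last exact: seg_integrable.
  apply: le_Rintegral => //.
  + exact: (integrableZl _ _ (seg_integrable K h K0)).
  + by apply: integrableS cih => //; apply: subset_itvr; rewrite bnd_simp.
  + move=> u /=; rewrite in_itv/= => /andP[Ku uh].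
    by rewrite ler_wpM2r//; apply: f_le; lra.
- have -> : \int[mu]_(u in `[0, h]) f u = \int[mu]_(u in `[h, h + h]) f (h + h - u).
    rewrite /Rintegral; congr fine; rewrite -(integral_reflect _ (h + h))//.
    suff -> : (fun u : R => h + h - u) @^-1` `[0, h] = `[h, h + h]%classic by [].
    by apply/seteqP; split => u /=; rewrite !in_itv/= => /andP[? ?];
      apply/andP; split; lra.
  have ir : mu.-integrable `[h, h + h] (EFin \o (fun u => f (h + h - u))).
    apply: (@le_integrable _ _ _ mu _ _ _ (EFin \o cst (f 0))) => //.
    + apply: measurable_funTS; apply/measurable_EFinP; apply: measurableT_comp => //.
      exact: measurable_funB.
    + move=> y /=; rewrite in_itv/= => /andP[y0 yx].
      by rewrite lee_fin !ger0_norm//; apply: f_le; rewrite subr_ge0.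
    + exact: cst_integrable.
  rewrite -RintegralZl//; apply: le_Rintegral => //.
  + exact: (integrableZl _ _ ir).
  + by apply: integrableS ci => //; apply: subset_itvr; rewrite bnd_simp.
  + move=> u /=; rewrite in_itv/= => /andP[hu uh].
    by rewrite mulrC ler_wpM2l//; exact: f_le.
Qed.

Lemma seg_cvg : \int[mu]_(u in `[0, x]) f u @[x --> +oo] -->
  \int[mu]_(u in `[0, +oo[) f u.
Proof.
set A := \int[mu]_(u in `[0, +oo[) f u.
have : A - \int[mu]_(u in `[x, +oo[) f u @[x --> +oo] --> A - 0.
  by apply: cvgB; [exact: cvg_cst|exact: tail_cvg0].
rewrite subr0; apply: cvg_trans; apply: near_eq_cvg; near=> x.
by rewrite /A (tail_split 0 x)// addrK.
Unshelve. all: by end_near. Qed.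

Let A := \int[mu]_(u in `[0, +oo[) f u.
Hypothesis A_gt0 : 0 < A.
Hypothesis self_conv_equiv : asymp_equiv self_conv (fun x => 2 * A * f x).

(** If [f] vanished at [x] it would vanish at every later point, where the ratio
    defining [asymp_equiv] would then be [0] rather than close to [1]. *)
Lemma strong_subexp_gt0 x : 0 < f x.
Proof.
rewrite lt_neqAle f_ge0 andbT eq_sym; apply/eqP => fx0.
have /cvgrPdist_lt/(_ 1 ltr01)[M [_ HM]] := self_conv_equiv.
have xM : M < Num.max x M + 1.
  by rewrite (@le_lt_trans _ _ (Num.max x M)) ?ltrDl// le_max lexx orbT.
have f0 : f (Num.max x M + 1) = 0.
  apply/eqP; rewrite eq_le f_ge0 andbT -fx0; apply: f_le.
  by rewrite (@le_trans _ _ (Num.max x M)) ?lerDl// le_max lexx.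
by have := HM _ xM; rewrite /= f0 mulr0 invr0 mulr0 subr0 normr1 ltxx.
Qed.

Lemma strong_subexp_conv_le e : 0 < e -> \forall x \near +oo, self_conv x <= (2 * A + e) * f x.
Proof.
move=> e0; have e'0 : 0 < e / (2 * A) by rewrite divr_gt0// mulr_gt0.
have /cvgrPdist_le/(_ _ e'0) := self_conv_equiv; apply: filterS => x.
have f0 := strong_subexp_gt0 x; have D0 : 0 < 2 * A * f x by rewrite !mulr_gt0.
rewrite ler_distlC => /andP[_]; rewrite ler_pdivrMr// => /le_trans; apply.
by rewrite le_eqVlt; apply/orP; left; apply/eqP; field; rewrite ?gt_eqF.
Qed.

(** At [y = x + K = 2h], [self_conv_ge] bounds the convolution below by
    [f y * (A + o(1) + s) + f x * (b + o(1))], where [s] and [b] are the integrals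
    of [f] over [0, K] and [K, +oo), so that [A = s + b].  The convolution is also
    at most [f y * (2 * A + o(1))]; subtracting leaves
    [f x * (b + o(1)) <= f y * (b + o(1))]. *)
Lemma strong_subexp_shift K t : 0 <= K -> t < 1 ->
  \forall x \near +oo, t * f x <= f (x + K).
Proof.
move=> K0 t1; have [t0|t0] := ltP t 0.
  by apply: nearW => x; rewrite (le_trans _ (f_ge0 _))// mulr_le0_ge0// ltW.
set b := \int[mu]_(u in `[K, +oo[) f u.
have b0 : 0 < b.
  apply: (@lt_le_trans _ _ (f (K + 1))); first exact: strong_subexp_gt0.
  rewrite /b (tail_split K (K + 1)) ?lerDl//.
  rewrite -[leLHS]addr0 lerD ?seg_ge0//.
  by rewrite (le_trans _ (seg_ge _ _ _ _)) ?lerDl// addrAC subrr add0r mul1r.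
have Ab : A = \int[mu]_(u in `[0, K]) f u + b by rewrite /A (tail_split 0 K).
(* With this value of [e], [t * (b + 2 * e) <= b - e], which converts the
   estimate [f x * (b - e) <= f y * (b + 2 * e)] below into the claim. *)
pose e := (1 - t) * b / 3.
have e0 : 0 < e by rewrite divr_gt0// mulr_gt0// subr_gt0.
have /cvgrPdist_le/(_ _ e0)[M [_ HM]] := seg_cvg.
have [N [_ HN]] := strong_subexp_conv_le _ e0.
near=> x; set y := x + K; set h := y / 2.
have yE : y = h + h by rewrite /h; field.
have Mh : M < h.
  rewrite /h /y ltr_pdivlMr//; rewrite -ltrBlDr.
  by near: x; apply: nbhs_pinfty_gt; rewrite num_real.
have Ny : N < y.
  rewrite /y; rewrite -ltrBlDr.
  by near: x; apply: nbhs_pinfty_gt; rewrite num_real.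
have Kh : K <= h.
  rewrite /h /y ler_pdivlMr//; rewrite -lerBlDr.
  by near: x; apply: nbhs_pinfty_ge; rewrite num_real.
have := self_conv_ge _ _ K0 Kh; rewrite -yE.
have := HN _ Ny; have := HM _ Mh; rewrite -/A /= ler_distlC => /andP[+ _].
rewrite (seg_split 0 K h)// Ab (_ : y - K = x); last by rewrite /y addrK.
set s := \int[mu]_(u in `[0, K]) f u; set s' := \int[mu]_(u in `[K, h]) f u.
have fy := strong_subexp_gt0 y; have fx := strong_subexp_gt0 x.
move=> h1 h2 h3.
have s'b : b - e <= s' by lra.
have fyx : f y * s' >= f y * (b - e) by rewrite ler_pM2l.
have fxx : f x * s' >= f x * (b - e) by rewrite ler_pM2l.
have key : f x * (b - e) <= f y * (b + 2 * e) by nra.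
have e3 : b - t * b = 3 * e by rewrite /e; field.
have et : 0 <= e * (1 - t) by rewrite mulr_ge0 ?subr_ge0 ?ltW.
have c : t * (b + 2 * e) <= b - e by lra.
have p : 0 < b + 2 * e by rewrite addr_gt0// mulr_gt0.
rewrite -(ler_pM2r p) (le_trans _ key)// [t * _]mulrC -mulrA.
by rewrite ler_pM2l.
Unshelve. all: by end_near. Qed.

End nonincreasing_tails.

(** * Pointwise bounds for the truncated integrated tail *)

Section Ghat_pointwise.
Context (R : realType).
Let mu := @lebesgue_measure R.
Variable F : R -> R.
Local Notation f := (tail F).
Local Notation J := (itail F).
Hypothesis f_le : {homo f : x y /~ x <= y}.
Hypothesis f_ge0 : forall x, 0 <= f x.
Hypothesis f_int : (\int[mu]_(u in `[0%R, +oo[) (f u)%:E < +oo)%E.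

Lemma itail_ge0 x : 0 <= J x.
Proof. exact: Rintegral_ge0. Qed.

Lemma itail_le x y : 0 <= x -> x <= y -> J y <= J x.
Proof. exact: tail_noninc. Qed.

Lemma itail_split x y : 0 <= x -> x <= y -> J x = \int[mu]_(u in `[x, y]) f u + J y.
Proof. exact: tail_split. Qed.

Lemma Ghat_bounded c x : 0 <= c -> 0 <= Ghat F c x <= c.
Proof.
move=> c0; rewrite /Ghat le_min c0 andbT ge_min lexx orbT andbT /Gfun.
by case: ifP => // _; exact: itail_ge0.
Qed.

Lemma Ghat_neg c x : x < 0 -> Ghat F c x = c.
Proof. by move=> x0; rewrite /Ghat /Gfun leNgt x0/= minxx. Qed.

Lemma Ghat_tail c x : 0 <= x -> Ghat F c x = Num.min (J x) c.
Proof. by move=> x0; rewrite /Ghat /Gfun x0. Qed.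

Lemma Ghat_noninc c x y : x <= y -> Ghat F c y <= Ghat F c x.
Proof.
move=> xy; have [x0|x0] := ltP x 0.
  by rewrite (Ghat_neg _ x)// /Ghat ge_min lexx orbT.
rewrite !Ghat_tail ?(le_trans x0)// le_min ge_min itail_le//=.
by rewrite ge_min lexx orbT.
Qed.

Lemma Ghat_measurable c : measurable_fun [set: R] (Ghat F c).
Proof. by apply: nonincreasing_measurable => // x y xy; exact: Ghat_noninc. Qed.

(** Large values are sent to [0] and not to [t]: a jump above [z] then
    contributes only through the indicator terms of the bounds below. *)
Definition trunc (t v : R) : R := if v <= t then v else 0.

(** For [v <= t] the difference [J (z - v) - J z] is the signed integral of
    the nonincreasing [f] between [z - v] and [z], hence at least [v * f z].
    The condition [J (z - t) <= c] makes the minimum with [c] inactive there.  For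
    [t < v <= z] monotonicity of [J] suffices, and for [z < v] both sides are
    [J z + c]. Negative contributions are moved across so that only
    nonnegative terms occur. *)
Lemma Ghat_ge c t z v : 0 < t -> t < z -> J (z - t) <= c ->
  J z + f z * trunc t (Num.max v 0) + (if z < v then c else 0) <=
  Ghat F c (z - v) + f z * Num.max (- v) 0 + (if z < v then J z else 0).
Proof.
move=> t0 tz Jc.
have Jzc : J z <= c by rewrite (le_trans _ Jc)// itail_le//; lra.
have [zv|vz] := ltP z v.
  have v0 : 0 < v by lra.
  rewrite (max_idPl _) ?(ltW v0)// (max_idPr _) ?oppr_le0 ?(ltW v0)//.
  have vt : (v <= t) = false by rewrite leNgt (lt_trans tz zv).
  by rewrite /trunc vt !mulr0 !addr0 Ghat_neg ?subr_lt0// addrC.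
rewrite !addr0 Ghat_tail ?subr_ge0//.
have [v0|v0] := ltP v 0.
  rewrite (max_idPl _) ?oppr_ge0 ?(ltW v0)//.
  rewrite /trunc (ltW t0) mulr0 addr0.
  have Jv : J (z - v) <= J z by apply: itail_le; lra.
  rewrite (min_idPl _) ?(le_trans Jv)//.
  rewrite (itail_split z (z - v)); [|lra|lra].
  rewrite [leLHS]addrC lerD2l (le_trans (seg_le R f f_le f_ge0 f_int _ _ _ _)) //; [lra|lra|].
  by rewrite addrAC subrr add0r mulrC.
rewrite (max_idPr _) ?oppr_le0// mulr0 addr0 /trunc.
have [vt|tv] := leP v t; last first.
  by rewrite mulr0 addr0 le_min Jzc andbT itail_le//; lra.
rewrite (min_idPl _); last by rewrite (le_trans _ Jc)// itail_le//; lra.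
rewrite (itail_split (z - v) z); [|lra|lra].
rewrite addrC lerD2r (le_trans _ (seg_ge R f f_le f_ge0 f_int _ _ _ _)) //; [|lra|lra].
by rewrite subKr mulrC.
Qed.

(** The exact gain [J (z - v) - J z] of a jump [v] in [0, z], and [0] for every
    other jump.  Writing it as an integral over the fixed interval [0, z] prepares
    the exchange of integrals in [gain_tonelli]. *)
Definition inner_gain (z v : R) : R :=
  \int[mu]_(u in `[0, z]) (if (z - u < v) && (v <= z) then f u else 0).

Lemma inner_gain_ge0 z v : 0 <= inner_gain z v.
Proof. by apply: Rintegral_ge0 => u _; case: ifP. Qed.

Lemma inner_gainE z v : 0 <= v -> v <= z ->
  inner_gain z v = \int[mu]_(u in `[z - v, z]) f u.
Proof.
move=> v0 vz; have zv0 : 0 <= z - v by rewrite subr_ge0.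
rewrite -Rintegral_itv_obnd_cbnd; last first.
  apply: integrableS (seg_integrable R f f_le f_ge0 f_int _ z zv0) => //.
  by apply: subset_itvr; rewrite bnd_simp.
have -> : `]z - v, z]%classic = `[0, z] `&` `]z - v, z]%classic.
  by rewrite setIidr//; apply: subset_itvr; rewrite bnd_simp.
rewrite Rintegral_mkcondr; apply: eq_Rintegral => u; rewrite inE/= in_itv/=.
move=> /andP[_ uz]; rewrite patchE vz andbT mem_setE in_itv/= uz andbT.
by rewrite ltrBlDr ltrBlDl.
Qed.

(** Forgetting the minimum with [c] only increases the value.  A jump [v] with
    [- K <= v < 0] loses the integral of [f] over an interval of length [- v]
    inside [z, z + K]; for larger negative jumps the loss is merely nonnegative. *)
Lemma Ghat_le c K z v : 0 <= c -> 0 <= K -> 0 <= z ->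
  Ghat F c (z - v) + f (z + K) * trunc K (Num.max (- v) 0) <=
  J z + (if z < v then c else 0) + inner_gain z v.
Proof.
move=> c0 K0 z0; have Q0 := inner_gain_ge0 z v; have J0 := itail_ge0 z.
have [zv|vz] := ltP z v.
  have v0 : 0 < v by lra.
  rewrite (max_idPr _) ?oppr_le0 ?(ltW v0)// /trunc K0 mulr0 addr0.
  by rewrite Ghat_neg ?subr_lt0//; lra.
rewrite addr0 Ghat_tail ?subr_ge0//.
have [v0|v0] := ltP v 0; last first.
  rewrite (max_idPr _) ?oppr_le0// /trunc K0 mulr0 addr0.
  rewrite inner_gainE// [leRHS]addrC -itail_split ?subr_ge0//; last by lra.
  by rewrite ge_min lexx.
rewrite (max_idPl _) ?oppr_ge0 ?(ltW v0)//.
rewrite (@le_trans _ _ (J (z - v) + f (z + K) * trunc K (- v)))//.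
  by rewrite lerD2r ge_min lexx.
rewrite (@le_trans _ _ (J z))//; last by lra.
rewrite (itail_split z (z - v)); [|lra|lra].
rewrite addrC lerD2r (le_trans _ (seg_ge R f f_le f_ge0 f_int _ _ _ _)) //; last by lra.
rewrite /trunc; case: ifP => vK; last by rewrite mulr0 mulr_ge0//; lra.
rewrite addrAC subrr add0r mulrC ler_wpM2l ?oppr_ge0 ?(ltW v0)//.
by apply: f_le; lra.
Qed.

End Ghat_pointwise.

Arguments trunc {R}.
Arguments inner_gain {R}.
Arguments self_conv {R}.

(** * One-step inequalities *)

Section increment.
Context d (T : measurableType d) (R : realType) (P : probability T R).
Let mu := @lebesgue_measure R.
Variables (V : {RV P >-> R}) (F : R -> R) (a : R).
Hypothesis V_cdf : forall x, cdf V x = (F x)%:E.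
Hypothesis V_int : P.-integrable [set: T] (EFin \o V).
Hypothesis V_mean : ('E_P[V] = (- a)%:E)%E.
Local Notation f := (tail F).
Local Notation J := (itail F).

Lemma ccdf_tail x : ccdf V x = (f x)%:E.
Proof. by rewrite ccdf_1_cdf V_cdf. Qed.

Lemma prob_gt x : P [set w | x < V w] = (f x)%:E.
Proof.
rewrite -ccdf_tail; congr (P _); apply/seteqP.
by split=> w /=; rewrite in_itv/= andbT.
Qed.

Lemma tail_ge0 x : 0 <= f x.
Proof. by rewrite -lee_fin -prob_gt. Qed.

Lemma tail_le : {homo f : x y /~ x <= y}.
Proof. by move=> x y xy; rewrite -lee_fin -!ccdf_tail; exact: ccdf_nonincreasing. Qed.

Let Vp w : R := Num.max (V w) 0.
Let Vm w : R := Num.max (- V w) 0.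

Lemma Vp_measurable : measurable_fun [set: T] Vp.
Proof. exact: measurable_funrpos. Qed.

Lemma Vp_integrable : P.-integrable [set: T] (EFin \o Vp).
Proof. exact: integrable_funrpos. Qed.

Lemma Vm_integrable : P.-integrable [set: T] (EFin \o Vm).
Proof. exact: integrable_funrneg. Qed.

(** For positive levels the positive part of [V] has the same tail as [V], so this
    is the tail formula for the expectation of a nonnegative variable. *)
Lemma integral_tail : (\int[mu]_(u in `[0%R, +oo[) (f u)%:E = \int[P]_w (Vp w)%:E)%E.
Proof.
have := @ge0_expectation_ccdf _ _ _ P V^\+%R (fun w => funrpos_ge0 _ _).
rewrite expectation_def => ->; apply: eq_integral => u.
rewrite inE/= in_itv/= andbT => u0; rewrite -ccdf_tail; congr (P _).
apply/seteqP; split => w /=; rewrite !in_itv/= !andbT /funrpos/= lt_max.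
  by move=> ->.
by rewrite (ltNge u 0) u0 orbF.
Qed.

Lemma Rintegral_tail : \int[mu]_(u in `[0, +oo[) f u = \int[P]_w Vp w.
Proof. by rewrite /Rintegral integral_tail. Qed.

Lemma integral_tail_lty : (\int[mu]_(u in `[0%R, +oo[) (f u)%:E < +oo)%E.
Proof.
rewrite integral_tail; have /integrableP[_] := Vp_integrable; apply: le_lt_trans.
apply: ge0_le_integral => //.
- by move=> w _; rewrite lee_fin le_max lexx orbT.
- exact/measurable_EFinP/Vp_measurable.
- by apply: measurableT_comp => //; exact/measurable_EFinP/Vp_measurable.
- by move=> w _ /=; rewrite lee_fin ler_norm.
Qed.

Lemma funrneg_funrpos_mean : \int[P]_w Vm w - \int[P]_w Vp w = a.
Proof.
have VE : \int[P]_w V w = - a by rewrite /Rintegral -expectation_def V_mean.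
have : \int[P]_w V w = \int[P]_w Vp w - \int[P]_w Vm w.
  rewrite -RintegralB//; [|exact: Vp_integrable|exact: Vm_integrable].
  apply: eq_Rintegral => w _; rewrite /Vm /Vp /Num.max.
  by case: ltP => ?; case: ltP => ?; lra.
by rewrite VE; lra.
Qed.

Lemma trunc_integrable t (g : T -> R) : (forall w, 0 <= g w) ->
  P.-integrable [set: T] (EFin \o g) -> P.-integrable [set: T] (EFin \o (trunc t \o g)).
Proof.
move=> g0 ig; have /measurable_EFinP mg := measurable_int _ ig.
apply: le_integrable ig => //.
  apply/measurable_EFinP; apply: measurable_fun_if => //.
  - exact: measurable_fun_ler.
  - exact: measurable_funTS.
move=> w _ /=; rewrite lee_fin /trunc; case: ifP => // _.
by rewrite normr0 normr_ge0.
Qed.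

(** Monotone convergence: [trunc n (g w)] is eventually equal to [g w]. *)
Lemma trunc_cvg (g : T -> R) e : 0 < e -> (forall w, 0 <= g w) ->
  P.-integrable [set: T] (EFin \o g) ->
  exists2 t : R, 0 < t & \int[P]_w g w - e <= \int[P]_w trunc t (g w).
Proof.
move=> e0 g0 ig.
have c : (\int[P]_w (trunc n%:R (g w))%:E @[n --> \oo] --> \int[P]_w (g w)%:E)%E.
  have -> : (\int[P]_w (g w)%:E = \int[P]_w (limn (fun n => (trunc n%:R (g w))%:E)))%E.
    apply: eq_integral => w _; apply/esym/cvg_lim => //.
    apply: cvg_near_cst; near=> n; rewrite /trunc ifT//.
    by near: n; exact: nbhs_infty_ger.
  apply: cvg_monotone_convergence => //.
  - by move=> n; exact: measurable_int (trunc_integrable n%:R g g0 ig).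
  - by move=> n w _; rewrite lee_fin /trunc; case: ifP.
  - move=> w _ m n mn; rewrite lee_fin /trunc; case: ifP => [gm|_].
      by rewrite ifT// (le_trans gm)// ler_nat.
    by case: ifP.
have c' : \int[P]_w trunc n%:R (g w) @[n --> \oo] --> \int[P]_w g w.
  apply: fine_cvg; rewrite fineK//; exact: integrable_fin_num.
have /cvgrPdist_le/(_ _ e0)[N _ HN] := c'.
exists N.+1%:R => //.
by have := HN N.+1 (leqnSn N); rewrite /= ler_distlC => /andP[].
Unshelve. all: by end_near. Qed.

Lemma gt_indic_integrable c z :
  P.-integrable [set: T] (EFin \o (fun w => if z < V w then c else 0)).
Proof.
apply: (@le_integrable _ _ _ P _ _ _ (EFin \o cst c)) => //.
- apply/measurable_EFinP; apply: measurable_fun_if => //.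
  exact: measurable_fun_ltr.
- by move=> w _ /=; rewrite lee_fin; case: ifP => // _; rewrite normr0.
- exact: finite_measure_integrable_cst.
Qed.

Lemma Rintegral_gt_indic c z : \int[P]_w (if z < V w then c else 0) = f z * c.
Proof.
have mA : measurable [set w | z < V w].
  have -> : [set w | z < V w] = V @^-1` `]z, +oo[.
    by apply/seteqP; split => w /=; rewrite in_itv/= andbT.
  exact: measurable_funPTI.
transitivity (\int[P]_w (c * \1_[set w | z < V w] w)).
  apply: eq_Rintegral => w _; rewrite indicE; have [zV|zV] := ltP z (V w).
    by rewrite mem_set// mulr1.
  by rewrite memNset ?mulr0//= ltNge zV.
rewrite RintegralZl//; last exact: integrable_indic.
by rewrite /Rintegral integral_indic// setIT/= prob_gt mulrC.
Qed.

Lemma Ghat_V_integrable c z : 0 <= c ->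
  P.-integrable [set: T] (EFin \o (fun w => Ghat F c (z - V w))).
Proof.
move=> c0; apply: (@bounded_integrable _ _ _ P _ c).
  apply: measurableT_comp; last exact: measurable_funB.
  exact: (Ghat_measurable _ _ tail_le tail_ge0 integral_tail_lty).
by move=> w; apply: Ghat_bounded => //; exact: tail_ge0.
Qed.

Lemma Rintegral_prob_cst c : \int[P]_w (cst c w) = c.
Proof. by rewrite Rintegral_cst//= probability_setT/= mulr1. Qed.

Lemma prob_cst_integrable c : P.-integrable [set: T] (EFin \o (cst c : T -> R)).
Proof. exact: finite_measure_integrable_cst. Qed.

Lemma Vp_ge0 w : 0 <= Vp w. Proof. by rewrite le_max lexx orbT. Qed.
Lemma Vm_ge0 w : 0 <= Vm w. Proof. by rewrite le_max lexx orbT. Qed.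

Lemma integrable_add (g h : T -> R) : P.-integrable [set: T] (EFin \o g) ->
  P.-integrable [set: T] (EFin \o h) -> P.-integrable [set: T] (EFin \o (fun w => g w + h w)).
Proof. by move=> ig ih; exact: integrableD ig ih. Qed.

Lemma integrable_scale k (g : T -> R) : P.-integrable [set: T] (EFin \o g) ->
  P.-integrable [set: T] (EFin \o (fun w => k * g w)).
Proof. by move=> ig; exact: (integrableZl _ k ig). Qed.

(** Averaging [Ghat_ge] gives a mean increment of at least
    [f z * (p + c - m - J z)], with [p] the truncated mean of the positive part and
    [m] the mean of the negative part.  Up to [eps / 2] from the truncation,
    [p - m] is [- a], and [J z <= eps / 2] for large [z]. *)
Lemma Ghat_one_step_ge eps : 0 < a -> 0 < eps -> exists2 M : R, 0 < M &
  forall z, M <= z -> Ghat F (a + eps) z <= \int[P]_w Ghat F (a + eps) (z - V w).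
Proof.
move=> a0 e0; set c := a + eps; have c0 : 0 < c by rewrite addr_gt0.
have e2 : 0 < eps / 2 by rewrite divr_gt0.
have [t t0 tE] := trunc_cvg Vp _ e2 Vp_ge0 Vp_integrable.
have m0 : 0 < Num.min (eps / 2) c by rewrite lt_min e2.
have /cvgrPdist_le/(_ _ m0)[N [_ HN]] := tail_cvg0 _ _ tail_le tail_ge0 integral_tail_lty.
exists (`|N| + t + 1) => [|z zM]; first by rewrite addr_gt0// ltr_wpDl.
have Nn := ler_norm N; have Nn0 := normr_ge0 N.
have Nz : N < z - t by lra.
have := HN _ Nz; rewrite sub0r normrN -/(itail F _) ger0_norm;
  last exact: (itail_ge0 _ _ tail_ge0).
rewrite le_min => /andP[Je Jc].
have Jzt : J z <= J (z - t) by apply: (itail_le _ _ tail_le tail_ge0 integral_tail_lty); lra.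
have zt : t < z by lra.
have iT := trunc_integrable t _ Vp_ge0 Vp_integrable.
have iT' := integrable_scale (f z) _ iT.
have iV := Vm_integrable; have iM := integrable_scale (f z) _ Vm_integrable.
have iG := Ghat_V_integrable _ z (ltW c0).
have iL := integrable_add _ _ (prob_cst_integrable (J z)) iT'.
have iR := integrable_add _ _ iG iM.
have iI := gt_indic_integrable ^~ z.
have := le_Rintegral (mu := P) measurableT (integrable_add _ _ iL (iI c))
  (integrable_add _ _ iR (iI (J z)))
  (fun w _ => Ghat_ge _ _ tail_le tail_ge0 integral_tail_lty c t z (V w) t0 zt Jc).
rewrite !RintegralD ?RintegralZl ?Rintegral_prob_cst ?Rintegral_gt_indic//;
  last exact: prob_cst_integrable.
rewrite Ghat_tail; last by lra.
have Jmin : Num.min (J z) c <= J z by rewrite ge_min lexx.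
have ms := funrneg_funrpos_mean; have fz := tail_ge0 z.
move: tE Jmin ms; set p := Rintegral _ _ (trunc t \o Vp); set m := Rintegral _ _ Vm.
set p' := Rintegral _ _ Vp; set S := Rintegral _ _ _ => tE Jmin ms L.
have : 0 <= f z * (p + c - m - J z).
  apply: mulr_ge0 => //; move: Je; rewrite /c; move: tE ms; rewrite -/p => tE ms Je; lra.
lra.
Qed.

Lemma seg_integrable0 z : mu.-integrable `[0, z] (EFin \o f).
Proof. exact: (seg_integrable _ _ tail_le tail_ge0 integral_tail_lty). Qed.

Let gain_integrand z w u := if (z - u < V w) && (V w <= z) then f u else 0.

Lemma gain_integrand_measurable z :
  measurable_fun [set: T * measurableTypeR R]
    (fun p : T * measurableTypeR R => gain_integrand z p.1 p.2).
Proof.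
have mV : measurable_fun [set: T * measurableTypeR R] (fun p => V p.1).
  exact: measurableT_comp.
apply: measurable_fun_if => //.
- apply: measurable_and.
    by apply: measurable_fun_ltr => //; apply: measurable_funB.
  exact: measurable_fun_ler.
- apply: measurable_funTS; apply: measurableT_comp => //.
  exact: (noninc_measurable _ _ tail_le).
Qed.

Lemma gain_integrand_bounded z w u : 0 <= gain_integrand z w u <= f u.
Proof. by rewrite /gain_integrand; case: ifP => _; rewrite !tail_ge0 lexx. Qed.

Lemma gain_integrand_integrable z w :
  mu.-integrable `[0, z] (EFin \o (fun u => gain_integrand z w u)).
Proof.
apply: le_integrable (seg_integrable0 z) => //.
- apply: measurable_funTS; apply/measurable_EFinP.
  exact: (measurableT_comp (gain_integrand_measurable z) (pair1_measurable w)).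
- move=> u _ /=; have /andP[g0 gf] := gain_integrand_bounded z w u.
  by rewrite lee_fin !ger0_norm ?tail_ge0.
Qed.

(** The integrand of [inner_gain] extended by [0] to the whole line, as Tonelli's
    theorem is stated for integrals over full spaces. *)
Let gain_kernel z (p : T * measurableTypeR R) : \bar R :=
  (if (0 <= p.2) && (p.2 <= z) then gain_integrand z p.1 p.2 else 0)%:E.

Lemma gain_kernel_ge0 z p : (0 <= gain_kernel z p)%E.
Proof.
rewrite lee_fin; case: ifP => // _.
by have /andP[] := gain_integrand_bounded z p.1 p.2.
Qed.

Lemma gain_kernel_measurable z :
  measurable_fun [set: T * measurableTypeR R] (gain_kernel z).
Proof.
apply/measurable_EFinP; apply: measurable_fun_if => //.
  by apply: measurable_and; exact: measurable_fun_ler.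
by apply: measurable_funTS; exact: gain_integrand_measurable.
Qed.

Lemma inner_gain_kernel z w :
  (inner_gain F z (V w))%:E = (\int[mu]_u gain_kernel z (w, u))%E.
Proof.
rewrite /inner_gain /Rintegral fineK.
  rewrite integral_mkcond; apply: eq_integral => u _.
  by rewrite patchE mem_setE in_itv /gain_kernel /=; case: ifP.
by apply: integrable_fin_num => //; exact: gain_integrand_integrable.
Qed.

Lemma gain_tonelli z :
  (\int[P]_w (inner_gain F z (V w))%:E =
   \int[mu]_(u in `[0%R, z]) \int[P]_w (gain_integrand z w u)%:E)%E.
Proof.
under eq_integral do rewrite inner_gain_kernel.
rewrite (fubini_tonelli _ (gain_kernel_measurable z) (gain_kernel_ge0 z)).
rewrite [RHS]integral_mkcond; apply: eq_integral => u _.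
rewrite patchE mem_setE in_itv /gain_kernel/=; case: ifP => // _.
by rewrite integral0.
Qed.

Lemma gain_integrand_mean z u : 0 <= u ->
  \int[P]_w gain_integrand z w u = f (z - u) * f u - f z * f u.
Proof.
move=> u0; rewrite -!Rintegral_gt_indic -RintegralB//; [|exact: gt_indic_integrable..].
apply: eq_Rintegral => w _; rewrite /gain_integrand.
have [zV|Vz] := ltP z (V w); rewrite ?andbF ?andbT ?subr0//.
by rewrite (le_lt_trans _ zV) ?subrr// gerBl.
Qed.

(** After Tonelli, the inner integral at [u] is
    [P (z - u < V <= z) * f u = (f (z - u) - f z) * f u]. *)
Lemma gain_mean z :
  (\int[P]_w (inner_gain F z (V w))%:E =
   (self_conv f z - f z * \int[mu]_(u in `[0, z]) f u)%:E)%E.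
Proof.
have ic := self_conv_integrable _ _ tail_le tail_ge0 integral_tail_lty z.
have is' : mu.-integrable `[0, z] (EFin \o (fun u => f z * f u)).
  exact: (integrableZl _ (f z) (seg_integrable0 z)).
rewrite gain_tonelli -RintegralZl//; last exact: seg_integrable0.
rewrite /self_conv -RintegralB// /Rintegral fineK; last first.
  apply: integrable_fin_num => //; exact: (integrableB _ ic is').
apply: eq_integral => u; rewrite inE/= in_itv/= => /andP[u0 uz].
rewrite -gain_integrand_mean// /Rintegral fineK//.
apply: integrable_fin_num => //; apply: (@bounded_integrable _ _ _ P _ (f u)).
  exact: (measurableT_comp (gain_integrand_measurable z) (pair2_measurable u)).
by move=> w; exact: gain_integrand_bounded.
Qed.

Lemma inner_gain_integrable z :
  P.-integrable [set: T] (EFin \o (fun w => inner_gain F z (V w))).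
Proof.
apply/integrableP; split.
  rewrite (_ : _ \o _ = fubini_F mu (gain_kernel z)).
    exact: measurable_fun_fubini_tonelli_F (gain_kernel_measurable z) (gain_kernel_ge0 z).
  by apply/funext => w /=; rewrite inner_gain_kernel.
under eq_integral => w _ do rewrite /= ger0_norm ?(inner_gain_ge0 _ _ tail_ge0)//.
by rewrite gain_mean ltry.
Qed.

Lemma Ghat_mean_le c K z : 0 <= c -> 0 <= K -> 0 <= z ->
  \int[P]_w Ghat F c (z - V w) + f (z + K) * \int[P]_w trunc K (Vm w) <=
  J z + f z * c + (self_conv f z - f z * \int[mu]_(u in `[0, z]) f u).
Proof.
move=> c0 K0 z0.
have iT := trunc_integrable K _ Vm_ge0 Vm_integrable.
have iT' := integrable_scale (f (z + K)) _ iT.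
have iG := Ghat_V_integrable _ z c0.
have iL := integrable_add _ _ iG iT'.
have iI := gt_indic_integrable c z.
have iC := prob_cst_integrable (J z).
have iR := integrable_add _ _ iC iI.
have iQ := inner_gain_integrable z.
have gE : \int[P]_w inner_gain F z (V w) =
    self_conv f z - f z * \int[mu]_(u in `[0, z]) f u.
  by rewrite /Rintegral gain_mean.
have L := le_Rintegral (mu := P) measurableT iL (integrable_add _ _ iR iQ)
  (fun w _ => Ghat_le _ _ tail_le tail_ge0 integral_tail_lty c K z (V w) c0 K0 z0).
rewrite !RintegralD ?RintegralZl ?Rintegral_prob_cst ?Rintegral_gt_indic// gE in L.
exact: L.
Qed.

Lemma tail_mass_gt0 : strong_subexponential F -> 0 < \int[mu]_(u in `[0, +oo[) f u.
Proof. by move=> [/andP[A0 _] _]; rewrite /Rintegral fine_gt0// A0 integral_tail_lty. Qed.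

(** [Ghat_mean_le] bounds the mean increment by
    [f z * c + self_conv f z - f z * s - f (z + K) * q], with [s] the integral of
    [f] over [0, z] and [q] the truncated mean of the negative part.  Asymptotically
    [self_conv f z] is [2 * p * f z], [s] is [p], and [q] is [m] up to the choice of
    [K], so what is left is [f z * (c + p - m) = - eps * f z]. *)
Lemma Ghat_one_step_le eps : 0 < eps -> eps < a -> strong_subexponential F ->
  exists2 M : R, 0 < M &
  forall z, M <= z -> \int[P]_w Ghat F (a - eps) (z - V w) <= Ghat F (a - eps) z.
Proof.
move=> e0 ea sexp; set c := a - eps.
have c0 : 0 < c by rewrite subr_gt0.
have ms := funrneg_funrpos_mean.
have p0 : 0 <= \int[P]_w Vp w by apply: Rintegral_ge0 => w _; exact: Vp_ge0.
have pE := Rintegral_tail.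
have e4 : 0 < eps / 4 by rewrite divr_gt0.
have [K K0 KE] := trunc_cvg Vm _ e4 Vm_ge0 Vm_integrable.
move: ms p0 pE KE; move: (\int[P]_w Vm w) (\int[P]_w Vp w) => m p ms p0 pE KE.
have am : a <= m by rewrite -ms gerBl.
have D0 : 0 < m - eps / 4 by lra.
have D1 : 0 < m - eps / 2 by lra.
(* Four errors have to fit into [eps]: [eps / 4] each for [self_conv] and [s],
   and [eps / 2] for the product of [q >= m - eps / 4] with the ratio
   [f (z + K) / f z >= th], since [th * (m - eps / 4) = m - eps / 2]. *)
pose th := (m - eps / 2) / (m - eps / 4).
have th1 : th < 1.
  by rewrite ltr_pdivrMr// mul1r ltrD2l ltrN2 ltr_pM2l// ltf_pV2 ?posrE ?ltr_nat.
have th0 : 0 < th by rewrite divr_gt0.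
have [N1 [_ H1]] := strong_subexp_shift _ _ tail_le tail_ge0 integral_tail_lty
  (tail_mass_gt0 sexp) (proj2 sexp) K th (ltW K0) th1.
have [N2 [_ H2]] := strong_subexp_conv_le _ _ tail_le tail_ge0
  (tail_mass_gt0 sexp) (proj2 sexp) _ e4.
have /cvgrPdist_le/(_ _ e4)[N3 [_ H3]] := seg_cvg _ _ tail_le tail_ge0 integral_tail_lty.
have /cvgrPdist_le/(_ _ c0)[N4 [_ H4]] := tail_cvg0 _ _ tail_le tail_ge0 integral_tail_lty.
exists (`|N1| + `|N2| + `|N3| + `|N4| + 1) => [|z zM].
  by rewrite ltr_wpDl// !addr_ge0.
have n1 := ler_norm N1; have n2 := ler_norm N2.
have n3 := ler_norm N3; have n4 := ler_norm N4.
have n1' := normr_ge0 N1; have n2' := normr_ge0 N2.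
have n3' := normr_ge0 N3; have n4' := normr_ge0 N4.
have z0 : 0 <= z by lra.
have := H4 z; rewrite sub0r normrN -/(itail F _) ger0_norm;
  last exact: (itail_ge0 _ _ tail_ge0).
move=> /(_ ltac:(lra)) Jc.
have := H3 z; rewrite pE ler_distlC => /(_ ltac:(lra)) /andP[+ _].
have := H2 z; rewrite pE => /(_ ltac:(lra)) /=.
have := H1 z => /(_ ltac:(lra)) /=.
rewrite Ghat_tail// (min_idPl Jc).
have := Ghat_mean_le _ _ _ (ltW c0) (ltW K0) z0.
have fz := tail_ge0 z; have fK := tail_ge0 (z + K).
move: KE; set q := \int[P]_w trunc K (Vm w).
set S := \int[P]_w Ghat F c _; set I := self_conv f z; set s := \int[mu]_(u in `[0, z]) f u.
move=> qE L f1 f2 f3.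
have q0 : m - eps / 4 <= q by [].
have thD : th * (m - eps / 4) = m - eps / 2 by rewrite /th divfK// gt_eqF.
have k1 : f z * (m - eps / 2) <= f (z + K) * q.
  rewrite -thD mulrCA mulrA; apply: ler_pM => //; first by rewrite mulr_ge0// ltW.
  exact: ltW.
have k2 : f z * (p - eps / 4) <= f z * s by rewrite ler_wpM2l.
have cE : c = m - p - eps by rewrite /c -ms.
have k3 : f z * c = f z * m - f z * p - f z * eps by rewrite cE; ring.
lra.
Qed.

End increment.
(** * The stopped process *)

Lemma Ghat_nonpos (R : realType) (F : R -> R) (c x : R) :
  (forall u, 0 <= tail F u) -> c <= 0 -> Ghat F c x = c.
Proof.
move=> f0 c0; rewrite /Ghat /Gfun; case: ifP => _; last by rewrite minxx.
by apply/min_idPr; rewrite (le_trans c0)//; exact: itail_ge0.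
Qed.

Lemma supermartingale_cst d (T : measurableType d) (R : realType)
    (P : probability T R) (xi : nat -> {RV P >-> R}) (c : R) :
  supermartingale P (natural_filtration xi) (fun _ _ => c).
Proof.
have ic : P.-integrable [set: T] (EFin \o (fun=> c)).
  exact: finite_measure_integrable_cst.
have mc n : sigma_meas (natural_filtration xi n) (fun=> c).
  by apply/sigma_measP; exact: measurable_cst.
by split=> // n; exists (fun=> c); split => //; apply: aeW.
Qed.

Theorem theorem3 (d : measure_display) (T : measurableType d) (R : realType)
    (P : probability T R) (xi : nat -> {RV P >-> R}) (F : R -> R) (a : R)
    (xi_indep : independent_family xi)
    (xi_cdf : forall (k : nat) (x : R), cdf (xi k) x = (F x)%:E)
    (a_gt0 : 0 < a)
    (xi_int : P.-integrable [set: T] (EFin \o xi 0%N))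
    (xi_mean : ('E_P[xi 0%N] = (- a)%:E)%E) :
  (long_tailed (xi 0%N) ->
   forall eps : R, 0 < eps ->
   exists R0 : R, 0 < R0 /\
   forall x : R, R0 < x ->
   submartingale P (natural_filtration xi) (stopped_Ghat F xi (a + eps) x R0))
  /\
  (long_tailed (xi 0%N) -> strong_subexponential F ->
   forall eps : R, 0 < eps ->
   exists R0 : R, 0 < R0 /\
   forall x : R, R0 < x ->
   supermartingale P (natural_filtration xi) (stopped_Ghat F xi (a - eps) x R0)).
Proof.
have f0 := tail_ge0 _ _ _ _ (xi 0%N) F (xi_cdf 0%N).
have fle := tail_le _ _ _ _ (xi 0%N) F (xi_cdf 0%N).
have fint := integral_tail_lty _ _ _ _ (xi 0%N) F (xi_cdf 0%N) xi_int.
have eq_cdf k : cdf (xi k) =1 cdf (xi 0%N) by move=> r; rewrite !xi_cdf.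
have mK c x : measurable_fun [set: R] (fun s => Ghat F c (x - s)).
  apply: measurableT_comp; first exact: (Ghat_measurable _ _ fle f0 fint).
  exact: measurable_funB.
have K0c c x (c0 : 0 <= c) s : 0 <= Ghat F c (x - s) <= c by exact: Ghat_bounded.
have stepE c x s : mean_step _ _ _ P (xi 0%N) (fun s => Ghat F c (x - s)) s =
    \int[P]_w Ghat F c (x - s - xi 0%N w).
  by rewrite /mean_step; under eq_integral do rewrite opprD addrA.
split=> [_ eps eps0|_ sF eps eps0].
  have [M M0 HM] := Ghat_one_step_ge _ _ _ _ _ _ _ (xi_cdf 0%N) xi_int xi_mean _ a_gt0 eps0.
  exists M; split=> // x _.
  apply: (stopped_submartingale _ _ _ _ xi _ (a + eps) (x - M) xi_indep eq_cdf (mK _ x)).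
    by move=> s; apply: K0c; rewrite addr_ge0// ltW.
  by move=> s sx; rewrite stepE; apply: HM; rewrite lerBrDl -lerBrDr.
(* For [a <= eps] the cap [a - eps] is nonpositive and [Ghat] is constant. *)
have [ea|ae] := ltP eps a; last first.
  exists 1; split=> // x _.
  rewrite (_ : stopped_Ghat _ _ _ _ _ = fun _ _ => a - eps).
    exact: supermartingale_cst.
  by apply/funext => n; apply/funext => w; apply: Ghat_nonpos; rewrite ?subr_le0.
have [M M0 HM] := Ghat_one_step_le _ _ _ _ _ _ _ (xi_cdf 0%N) xi_int xi_mean _ eps0 ea sF.
exists M; split=> // x _.
apply: (stopped_supermartingale _ _ _ _ xi _ (a - eps) (x - M) xi_indep eq_cdf (mK _ x)).
  by move=> s; apply: K0c; rewrite subr_ge0 ltW.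
by move=> s sx; rewrite stepE; apply: HM; rewrite lerBrDl -lerBrDr.
Qed.
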